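(* If $\nu$ is a pure-like mixture, then the sequence $(E_k(\nu))_{k\ge0}$ is strictly decreasing, and $E_k(\nu)$ converges to $E_\infty^+$ as $k\to\infty$.
   Context: A mixture is $\nu(t)=\sum_{p\ge2}\beta_p^2t^p$, where $(\beta_p)_{p\ge2}$ are nonnegative reals with $\sum_{p\ge2}2^p\beta_p<\infty$ and $\sum_{p\ge2}\beta_p^2=1$. Write $\nu'=\nu'(1)$, $\nu''=\nu''(1)$, $\alpha^2=\nu''+\nu'-\nu'^2\ge0$. The mixture is pure if $\nu(t)=t^p$ for a single $p$; this is equivalent to $\alpha=0$. The mixture $\nu$ is called pure-like if $$G(\nu',\nu''):=\log\frac{\nu''}{\nu'}-\frac{(\nu''-\nu')(\nu''-\nu'+\nu'^2)}{\nu''\nu'^2}>0.$$ Let $E_\infty=\dfrac{2\nu''-\alpha^2}{\nu'\sqrt{\nu''}}$ and $$E_\infty^{+}=\frac{2\nu'\sqrt{\nu''}+\sqrt{4\nu''\nu'^2-(\nu''+\nu')\left(2(\nu''-\nu'+\nu'^2)-\alpha^2\log\frac{\nu''}{\nu'}\right)}}{\nu'+\nu''},$$ $$F(\lambda,y)=\frac12\left(-\frac{\nu''+\nu'}{\alpha^2}y^2+\frac{2\sqrt2\sqrt{\nu''}\,\nu'}{\alpha^2}\lambda y-\frac{\nu''-\nu'+\nu'^2}{\alpha^2}\lambda^2\right),\qquad I_1(x)=\int_{\sqrt2}^x\sqrt{z^2-2}\,dz\quad(x\ge\sqrt2).$$ For integer $k\ge0$ and $u\ge-E_\infty$: $\theta_{k,\nu}(u)=\frac12\log\frac{\nu''}{\nu'}+F(-\sqrt2,u)$.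 For $u<-E_\infty$: $\theta_{k,\nu}(u)=\frac12\log\frac{\nu''}{\nu'}+F(\lambda_k^*[u],u)-(k+1)I_1(|\lambda_k^*[u]|)$, where $\lambda_k^*[u]$ is the unique $\lambda$ with $\frac{\nu'\sqrt{2\nu''}\,u}{\nu''-\nu'+\nu'^2}<\lambda\le-\sqrt2$ and $\frac{\nu'\sqrt{2\nu''}}{\alpha^2}u-\frac{\nu''-\nu'+\nu'^2}{\alpha^2}\lambda+(k+1)\sqrt{\lambda^2-2}=0$. These formulas are written for $\alpha\neq0$; the complexity functions of the pure case ($\alpha=0$) are obtained from them by taking $\alpha\to0$. $E_k(\nu)>0$ is the unique solution $E$ in $(E_\infty,\infty)$ of $\theta_{k,\nu}(-E)=0$; that is, $-E_k(\nu)$ is the smallest zero of $\theta_{k,\nu}$. *)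

(* Defs.v *)
From Stdlib Require Import Reals.
From Coquelicot Require Import Coquelicot.
Open Scope R_scope.

(** The family [(beta_p)_{p >= 2}] is encoded as a sequence indexed by all of
    [nat] that vanishes at [0] and [1]. *)
Definition is_mixture (beta : nat -> R) : Prop :=
  beta 0%nat = 0 /\ beta 1%nat = 0 /\
  (forall p, 0 <= beta p) /\
  ex_series (fun p => 2 ^ p * beta p) /\
  is_series (fun p => beta p ^ 2) 1.

Definition nu (beta : nat -> R) (t : R) : R := PSeries (fun p => beta p ^ 2) t.

Definition nu1 (beta : nat -> R) : R := Derive (nu beta) 1.
Definition nu2 (beta : nat -> R) : R := Derive_n (nu beta) 2 1.

(** All the functions attached to a mixture depend on it only through
    [a = nu'(1)] and [b = nu''(1)]. *)

Definition alpha2 (a b : R) : R := b + a - a ^ 2.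

Definition G (a b : R) : R :=
  ln (b / a) - (b - a) * (b - a + a ^ 2) / (b * a ^ 2).

Definition pure_like (beta : nat -> R) : Prop := 0 < G (nu1 beta) (nu2 beta).

Definition E_infty (a b : R) : R := (2 * b - alpha2 a b) / (a * sqrt b).

Definition E_infty_plus (a b : R) : R :=
  (2 * a * sqrt b
   + sqrt (4 * b * a ^ 2
           - (b + a) * (2 * (b - a + a ^ 2) - alpha2 a b * ln (b / a))))
  / (a + b).

Definition F (a b lambda y : R) : R :=
  / 2 * (- ((b + a) / alpha2 a b) * y ^ 2
         + 2 * sqrt 2 * sqrt b * a / alpha2 a b * lambda * y
         - (b - a + a ^ 2) / alpha2 a b * lambda ^ 2).

Definition I1 (x : R) : R := RInt (fun z => sqrt (z ^ 2 - 2)) (sqrt 2) x.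

(** Meaningful for [alpha2 a b > 0] and [u < - E_infty a b]. *)
Definition lambda_star (a b : R) (k : nat) (u : R) : R :=
  iota (fun lambda : R =>
    a * sqrt (2 * b) * u / (b - a + a ^ 2) < lambda <= - sqrt 2 /\
    a * sqrt (2 * b) / alpha2 a b * u
    - (b - a + a ^ 2) / alpha2 a b * lambda
    + (INR k + 1) * sqrt (lambda ^ 2 - 2) = 0).

Definition theta_mixed (a b : R) (k : nat) (u : R) : R :=
  if Rle_dec (- E_infty a b) u then
    / 2 * ln (b / a) + F a b (- sqrt 2) u
  else
    / 2 * ln (b / a) + F a b (lambda_star a b k u) u
    - (INR k + 1) * I1 (Rabs (lambda_star a b k u)).

(** In the pure case the complexity is the limit of the formula as [alpha -> 0],
    where [nu'(1) = a] is kept fixed and [b = a ^ 2 - a + alpha ^ 2], so that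
    [alpha2 a b = alpha ^ 2].  It takes values in [Rbar]: the limit is [m_infty]
    when [u > - E_infty]. *)
Definition theta (beta : nat -> R) (k : nat) (u : R) : Rbar :=
  let a := nu1 beta in
  let b := nu2 beta in
  if Req_EM_T (alpha2 a b) 0 then
    Lim (fun alpha => theta_mixed a (a ^ 2 - a + alpha ^ 2) k u) 0
  else Finite (theta_mixed a b k u).

Definition E_level (beta : nat -> R) (k : nat) : R :=
  iota (fun E : R =>
    E_infty (nu1 beta) (nu2 beta) < E /\ theta beta k (- E) = Finite 0).

(* Main.v *)
Require Import Defs.
From Stdlib Require Import Reals Lra Lia Psatz.
From Coquelicot Require Import Coquelicot.
Open Scope R_scope.

(** Write [a = nu'(1)], [b = nu''(1)], [A = alpha2 a b], [c = b - a + a ^ 2],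
    [m = k + 1], and parametrize by [t = - lambda] instead of [u = - E].  The
    equation that defines the critical point gives the energy explicitly:
      [a * sqrt (2 * b) * E = c * t + A * m * sqrt (t ^ 2 - 2)].
    Completing the square in [F] with this equation gives
      [theta = / 2 * ln (b / a) - (b - a) / (2 * c) * E ^ 2
               - A / (2 * c) * m ^ 2 * (t ^ 2 - 2) - m * I1 t].
    Neither formula has a pole at [A = 0], so mixed and pure mixtures are treated
    alike; the pure case only needs the passage to the limit of
    [theta_mixed_pure_limit].

    The energy is increasing in [t], from [E_infty] at [t = sqrt 2] to infinity,
    and [theta] is visibly decreasing in [t], from [G a b / 2 > 0] to minus
    infinity.  Hence there is exactly one zero beyond [E_infty]
    ([E_level_spec]).

    At a fixed energy [theta] decreases strictly when [m] increases
    ([complexity_decr_index]), by convexity of [I1]; so its zero decreases too.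

    At the zero [t_k] the formula for [theta] gives
    [(k + 1) * I1 t_k <= ln (b / a) / 2], so [t_k] tends to [sqrt 2].  On the other
    hand the quadratic polynomial whose largest root is [E_infty_plus] takes at
    [E_k] a value between [0] and a constant times [t_k - sqrt 2]
    ([limit_poly_bounds]).  As [E_k] lies to the right of its vertex, [E_k] is at
    least [E_infty_plus], and tends to it ([E_infty_plus_gap]). *)

(** * The rate function *)

Definition dI1 (t : R) : R := sqrt (t ^ 2 - 2).

Lemma sqrt2_sq : sqrt 2 ^ 2 = 2.
Proof. replace (sqrt 2 ^ 2) with (sqrt 2 * sqrt 2) by ring. apply sqrt_sqrt; lra. Qed.

Lemma sqrt2_bounds : 1 < sqrt 2 < 2.
Proof.
assert (H := sqrt2_sq); assert (H0 := sqrt_pos 2).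
split; nra.
Qed.

Lemma dI1_sqrt2 : dI1 (sqrt 2) = 0.
Proof. unfold dI1; rewrite sqrt2_sq, Rminus_diag; apply sqrt_0. Qed.

Lemma dI1_ge0 (t : R) : 0 <= dI1 t.
Proof. apply sqrt_pos. Qed.

Lemma dI1_sq (t : R) : sqrt 2 <= t -> dI1 t ^ 2 = t ^ 2 - 2.
Proof.
intros Ht; unfold dI1.
replace (sqrt (t ^ 2 - 2) ^ 2) with (sqrt (t ^ 2 - 2) * sqrt (t ^ 2 - 2)) by ring.
apply sqrt_sqrt.
assert (H := sqrt2_sq); assert (H0 := sqrt2_bounds); nra.
Qed.

Lemma dI1_incr (s t : R) : sqrt 2 <= s -> s <= t -> dI1 s <= dI1 t.
Proof.
intros Hs Hst; apply sqrt_le_1_alt.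
assert (H0 := sqrt2_bounds); nra.
Qed.

Lemma dI1_gt0 (t : R) : sqrt 2 < t -> 0 < dI1 t.
Proof.
intros Ht; apply sqrt_lt_R0.
assert (H := sqrt2_sq); assert (H0 := sqrt2_bounds); nra.
Qed.

Lemma dI1_le (t : R) : sqrt 2 <= t -> dI1 t <= t.
Proof.
intros Ht; assert (H := dI1_sq t Ht); assert (H0 := sqrt2_bounds).
assert (H1 := dI1_ge0 t); nra.
Qed.

Lemma continuous_dI1 (t : R) : continuous dI1 t.
Proof.
apply continuous_sqrt_comp.
apply (ex_derive_continuous (V := R_NormedModule) (fun x => x ^ 2 - 2)).
now auto_derive.
Qed.

Lemma is_derive_I1 (t : R) : is_derive I1 t (dI1 t).
Proof.
apply (is_derive_RInt dI1 I1 (sqrt 2) t).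
- apply filter_forall; intros y.
  apply (RInt_correct (V := R_CompleteNormedModule) dI1), ex_RInt_continuous.
  intros z _; apply continuous_dI1.
- apply continuous_dI1.
Qed.

Lemma continuous_I1 (t : R) : continuous I1 t.
Proof.
apply (ex_derive_continuous (V := R_NormedModule)).
exists (dI1 t); apply is_derive_I1.
Qed.

Lemma I1_sqrt2 : I1 (sqrt 2) = 0.
Proof. exact (RInt_point _ _). Qed.

(** The derivative of [I1] is increasing, so on an interval the slope of [I1]
    lies between its endpoint values.  Strict monotonicity of [I1], its growth at
    infinity and the comparison of two indices all rest on these two bounds. *)
Lemma I1_increment (s t : R) : sqrt 2 <= s -> s <= t ->
  dI1 s * (t - s) <= I1 t - I1 s <= dI1 t * (t - s).
Proof.
intros Hs Hst.
destruct (MVT_gen I1 s t dI1) as [x [Hx ->]].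
- intros x _; apply is_derive_I1.
- intros x _; apply continuity_pt_filterlim, continuous_I1.
- rewrite Rmin_left, Rmax_right in Hx by lra.
  assert (dI1 s <= dI1 x) by (apply dI1_incr; lra).
  assert (dI1 x <= dI1 t) by (apply dI1_incr; lra).
  nra.
Qed.

Lemma I1_incr (s t : R) : sqrt 2 <= s -> s < t -> I1 s < I1 t.
Proof.
intros Hs Hst.
set (r := (s + t) / 2).
assert (H1 : 0 < dI1 r) by (apply dI1_gt0; unfold r; lra).
assert (H2 := I1_increment s r Hs ltac:(unfold r; lra)).
assert (H3 := I1_increment r t ltac:(unfold r; lra) ltac:(unfold r; lra)).
assert (H4 := dI1_ge0 s).
assert (r - s > 0 /\ t - r > 0) by (unfold r; lra).
nra.
Qed.

Lemma I1_gt0 (t : R) : sqrt 2 < t -> 0 < I1 t.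
Proof. intros Ht; rewrite <- I1_sqrt2; apply I1_incr; lra. Qed.

(** * Critical points as a parameter *)

(** Up to the factor [- / alpha2 a b], the second derivative of [F a b] in its
    first variable. *)
Definition curv (a b : R) : R := b - a + a ^ 2.

(** With [lambda = - t], the energy [E = - u] at which [lambda] solves the
    critical equation for the index [m = k + 1].  The equation is linear in [u]
    and has been multiplied by [alpha2 a b], so that it still makes sense for
    pure mixtures. *)
Definition energy (a b m t : R) : R :=
  (curv a b * t + alpha2 a b * m * dI1 t) / (a * sqrt (2 * b)).

(** The value of [theta] at [u = - E], when [- t] is the critical point
    there.  Completing the square in [F] cancels the poles at [alpha2 a b = 0]. *)
Definition complexity (a b m E t : R) : R :=
  / 2 * ln (b / a) - (b - a) / (2 * curv a b) * E ^ 2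
  - alpha2 a b / (2 * curv a b) * m ^ 2 * (t ^ 2 - 2) - m * I1 t.

(** What the proof uses of the pair [(nu'(1), nu''(1))] of a pure-like mixture,
    besides [0 < G a b]. *)
Record admissible (a b : R) : Prop := {
  adm_a : 0 < a;
  adm_b : a < b;
  adm_var : 0 <= alpha2 a b }.

Lemma curv_gt0 (a b : R) : admissible a b -> 0 < curv a b.
Proof. intros []; unfold curv; nra. Qed.

Lemma scale_gt0 (a b : R) : admissible a b -> 0 < a * sqrt (2 * b).
Proof.
intros []; apply Rmult_lt_0_compat; auto; apply sqrt_lt_R0; lra.
Qed.

Lemma energy_eq (a b m t E : R) : admissible a b ->
  energy a b m t = E <->
  a * sqrt (2 * b) * E = curv a b * t + alpha2 a b * m * dI1 t.
Proof.
intros H; assert (H0 := scale_gt0 a b H); unfold energy; split.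
- intros <-; field; split; intros Hz; rewrite Hz in H0; lra.
- intros HE; rewrite <- HE; field; split; intros Hz; rewrite Hz in H0; lra.
Qed.

Lemma energy_sqrt2 (a b m : R) : admissible a b ->
  energy a b m (sqrt 2) = E_infty a b.
Proof.
intros H; unfold energy, E_infty; rewrite dI1_sqrt2, sqrt_mult by (destruct H; lra).
assert (Hb : 0 < sqrt b) by (apply sqrt_lt_R0; destruct H; lra).
assert (H2 := sqrt2_bounds).
unfold curv, alpha2; field; destruct H; lra.
Qed.

Lemma energy_incr (a b m s t : R) : admissible a b -> 0 <= m ->
  sqrt 2 <= s -> s < t -> energy a b m s < energy a b m t.
Proof.
intros H Hm Hs Hst; unfold energy.
apply Rmult_lt_compat_r; [now apply Rinv_0_lt_compat, scale_gt0|].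
assert (H0 := curv_gt0 a b H).
assert (H1 := dI1_incr s t Hs ltac:(lra)).
assert (0 <= alpha2 a b * m) by (destruct H; nra).
nra.
Qed.

Lemma continuous_energy (a b m t : R) : continuous (energy a b m) t.
Proof.
unfold energy.
apply (continuous_mult (fun t => curv a b * t + alpha2 a b * m * dI1 t)
  (fun _ => / (a * sqrt (2 * b)))); [|apply continuous_const].
apply (continuous_plus (fun t => curv a b * t)
  (fun t => alpha2 a b * m * dI1 t)).
- apply (continuous_mult (fun _ => curv a b) (fun t => t));
    [apply continuous_const | apply continuous_id].
- apply (continuous_mult (fun _ => alpha2 a b * m) dI1);
    [apply continuous_const | apply continuous_dI1].
Qed.

(** Without its nonnegative term in [dI1] the energy is linear in [t], hence
    reaches [E] at some [T]; with that term its value at [T] is at least [E], and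
    the intermediate value theorem applies. *)
Lemma energy_surj (a b m E : R) : admissible a b -> 0 <= m ->
  E_infty a b < E -> exists t, sqrt 2 < t /\ energy a b m t = E.
Proof.
intros H Hm HE.
assert (H0 := curv_gt0 a b H); assert (H1 := scale_gt0 a b H).
set (T := a * sqrt (2 * b) * E / curv a b).
assert (HT : a * sqrt (2 * b) * E = curv a b * T)
  by (unfold T; field; lra).
assert (HTl : sqrt 2 < T).
{ rewrite <- (energy_sqrt2 a b 0 H) in HE.
  assert (Hl := proj1 (energy_eq a b 0 (sqrt 2) _ H) eq_refl).
  rewrite dI1_sqrt2 in Hl; nra. }
assert (HlT : E <= energy a b m T).
{ apply (Rmult_le_reg_l _ _ _ H1).
  rewrite (proj1 (energy_eq a b m T _ H) eq_refl), HT.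
  assert (Hr := dI1_ge0 T).
  assert (0 <= alpha2 a b * m) by (destruct H; nra).
  nra. }
destruct (IVT_gen (energy a b m) (sqrt 2) T E) as [t [Ht HtE]].
- intros t; apply continuity_pt_filterlim, continuous_energy.
- rewrite energy_sqrt2, Rmin_left, Rmax_right by (auto; lra); lra.
- rewrite Rmin_left, Rmax_right in Ht by lra.
  exists t; split; auto.
  destruct (Rle_lt_or_eq_dec _ _ (proj1 Ht)) as [|Heq]; auto.
  rewrite <- Heq, energy_sqrt2 in HtE by auto; lra.
Qed.

(** The critical equation at [u = - E] says that the energy of [- lambda] is [E],
    and [energy] is injective.  The strict lower bound imposed on [lambda] holds
    because the term in [dI1] is positive at [t]. *)
Lemma lambda_star_energy (a b : R) (k : nat) (t : R) :
  admissible a b -> 0 < alpha2 a b -> sqrt 2 < t ->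
  lambda_star a b k (- energy a b (INR k + 1) t) = - t.
Proof.
intros H HA Ht.
assert (H0 := curv_gt0 a b H); assert (H1 := scale_gt0 a b H).
set (E := energy a b (INR k + 1) t).
assert (HE := proj1 (energy_eq a b (INR k + 1) t E H) eq_refl).
assert (Hk := pos_INR k).
assert (H2 := sqrt2_bounds).
assert (Hcrit : forall l, a * sqrt (2 * b) / alpha2 a b * - E
    - (b - a + a ^ 2) / alpha2 a b * l + (INR k + 1) * sqrt (l ^ 2 - 2) = 0
    <-> a * sqrt (2 * b) * E
        = curv a b * (- l) + alpha2 a b * (INR k + 1) * dI1 (- l)).
{ intros l; unfold dI1, curv.
  replace ((- l) ^ 2) with (l ^ 2) by ring.
  generalize (sqrt (l ^ 2 - 2)) (sqrt (2 * b)); intros r s.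
  assert (Heq : a * s / alpha2 a b * - E - (b - a + a ^ 2) / alpha2 a b * l
     + (INR k + 1) * r = / alpha2 a b * (- (a * s * E)
       + (b - a + a ^ 2) * - l + alpha2 a b * (INR k + 1) * r))
    by (field; lra).
  rewrite Heq; split; intros Hz.
  - apply Rmult_integral in Hz; destruct Hz as [Hz|Hz]; [|lra].
    assert (Hi := Rinv_0_lt_compat _ HA); lra.
  - rewrite Hz; ring. }
unfold lambda_star; apply (iota_unique (V := R_CompleteNormedModule)).
- intros l [[_ Hl] Hc]; apply Hcrit in Hc.
  apply (energy_eq a b (INR k + 1) (- l) E H) in Hc.
  destruct (Rtotal_order (- l) t) as [Hlt|[Heq|Hgt]].
  + assert (Hi := energy_incr a b (INR k + 1) (- l) t H
      ltac:(lra) ltac:(lra) Hlt); unfold E in Hc; lra.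
  + lra.
  + assert (Hi := energy_incr a b (INR k + 1) t (- l) H
      ltac:(lra) ltac:(lra) Hgt); unfold E in Hc; lra.
- split; [split; [|lra]|].
  + apply (Rmult_lt_reg_r (curv a b)); auto.
    unfold Rdiv; fold (curv a b); rewrite Rmult_assoc, Rinv_l by lra.
    assert (0 < alpha2 a b * (INR k + 1) * dI1 t).
    { apply Rmult_lt_0_compat; [nra|now apply dI1_gt0]. }
    lra.
  + apply Hcrit; rewrite Ropp_involutive; exact HE.
Qed.

(** The critical equation expresses [(k + 1) sqrt (lambda^2 - 2)] as a linear
    form in [lambda] and [u]; its square accounts for all of [F] except a multiple
    of [u^2]. *)
Lemma theta_mixed_energy (a b : R) (k : nat) (t : R) :
  admissible a b -> 0 < alpha2 a b -> sqrt 2 < t ->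
  let E := energy a b (INR k + 1) t in
  theta_mixed a b k (- E) = complexity a b (INR k + 1) E t.
Proof.
intros H HA Ht E.
assert (Hk := pos_INR k).
assert (HE := energy_incr a b (INR k + 1) (sqrt 2) t H ltac:(lra) ltac:(lra) Ht).
rewrite energy_sqrt2 in HE by auto; fold E in HE.
unfold theta_mixed; destruct (Rle_dec (- E_infty a b) (- E)) as [Hle|_]; [lra|].
unfold E at 1 3; rewrite lambda_star_energy by auto.
assert (H2 := sqrt2_bounds).
rewrite Rabs_Ropp, Rabs_right by lra.
assert (Heq : F a b (- t) (- E) = - (b - a) / (2 * curv a b) * E ^ 2
   - alpha2 a b / (2 * curv a b) * (INR k + 1) ^ 2 * (t ^ 2 - 2)).
{ assert (HD := proj1 (energy_eq a b (INR k + 1) t E H) eq_refl).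
  assert (H0 := curv_gt0 a b H).
  rewrite <- (dI1_sq t) by lra.
  assert (Hr : (INR k + 1) * dI1 t
     = (a * sqrt (2 * b) * E - curv a b * t) / alpha2 a b)
    by (rewrite HD; field; lra).
  replace ((INR k + 1) ^ 2) with ((INR k + 1) * (INR k + 1)) by ring.
  replace (alpha2 a b / (2 * curv a b) * ((INR k + 1) * (INR k + 1)) * dI1 t ^ 2)
   with (alpha2 a b / (2 * curv a b) * ((INR k + 1) * dI1 t) ^ 2) by (field; lra).
  rewrite Hr; unfold F; rewrite sqrt_mult by (destruct H; lra).
  assert (Hs2 := sqrt2_sq).
  assert (Hsb : sqrt b ^ 2 = b) by (rewrite pow2_sqrt; destruct H; lra).
  fold (curv a b).
  set (r := sqrt 2) in *; set (s := sqrt b) in *.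
  set (c := curv a b) in *; set (A := alpha2 a b) in *.
  apply (Rmult_eq_reg_l (2 * A * c)); [|nra].
  transitivity (c * (- (b + a) * E ^ 2 + 2 * r * s * a * t * E - c * t ^ 2));
    [field; lra|].
  transitivity (- (b - a) * A * E ^ 2 - (r ^ 2 * s ^ 2 * a ^ 2 * E ^ 2
    - 2 * a * r * s * E * c * t + c ^ 2 * t ^ 2)); [|field; lra].
  rewrite Hs2, Hsb; unfold c, A, curv, alpha2; ring. }
rewrite Heq; unfold complexity, Rdiv; ring.
Qed.

(** * The zero of the complexity for one index *)

Lemma E_infty_gt0 (a b : R) : admissible a b -> 0 < E_infty a b.
Proof.
intros H; rewrite <- (energy_sqrt2 a b 0 H); unfold energy.
rewrite dI1_sqrt2; apply Rdiv_lt_0_compat; [|now apply scale_gt0].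
assert (H0 := curv_gt0 a b H); assert (H2 := sqrt2_bounds); nra.
Qed.

Lemma energy_gt (a b m t : R) : admissible a b -> 0 <= m -> sqrt 2 < t ->
  E_infty a b < energy a b m t.
Proof.
intros H Hm Ht; rewrite <- (energy_sqrt2 a b m H); apply energy_incr; auto; lra.
Qed.

(** After the square is completed, each of the three varying terms of
    [complexity] is monotone: [E] is positive and increases with [t], [t ^ 2]
    increases, and so does [I1].  No differentiation of [theta] is needed. *)
Lemma complexity_decr (a b m s t : R) : admissible a b -> 0 < m ->
  sqrt 2 <= s -> s < t ->
  complexity a b m (energy a b m t) t < complexity a b m (energy a b m s) s.
Proof.
intros H Hm Hs Hst.
assert (H0 := curv_gt0 a b H); assert (H2 := sqrt2_bounds).
assert (Hl := energy_incr a b m s t H ltac:(lra) Hs Hst).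
assert (Hl0 : 0 < energy a b m s).
{ apply Rlt_le_trans with (E_infty a b); [now apply E_infty_gt0|].
  destruct (Rle_lt_or_eq_dec _ _ Hs) as [Hs'| <-].
  - left; apply energy_gt; auto; lra.
  - rewrite energy_sqrt2; auto; lra. }
assert (HI := I1_incr s t Hs Hst).
assert (Hc1 : 0 <= (b - a) / (2 * curv a b)).
{ left; apply Rdiv_lt_0_compat; destruct H; lra. }
assert (Hc2 : 0 <= alpha2 a b / (2 * curv a b) * m ^ 2).
{ apply Rmult_le_pos; [|nra].
  apply Rmult_le_pos; [now destruct H|left; apply Rinv_0_lt_compat; lra]. }
assert (HE2 : energy a b m s ^ 2 <= energy a b m t ^ 2) by nra.
assert (Ht2 : s ^ 2 - 2 <= t ^ 2 - 2) by nra.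
assert (X1 := Rmult_le_compat_l _ _ _ Hc1 HE2).
assert (X2 := Rmult_le_compat_l _ _ _ Hc2 Ht2).
assert (X3 := Rmult_lt_compat_l _ _ _ Hm HI).
unfold complexity; lra.
Qed.

(** This is where the function [G] comes from: it is twice the value of every
    [theta] at [- E_infty], which the pure-like hypothesis makes positive. *)
Lemma complexity_start (a b m : R) : admissible a b ->
  complexity a b m (energy a b m (sqrt 2)) (sqrt 2) = G a b / 2.
Proof.
intros H; assert (H0 := curv_gt0 a b H).
rewrite energy_sqrt2 by auto.
unfold complexity, G; rewrite I1_sqrt2, sqrt2_sq.
replace (E_infty a b ^ 2) with (curv a b ^ 2 / (a ^ 2 * b)).
- fold (curv a b); field; destruct H; lra.
- unfold E_infty; assert (Hsb : sqrt b ^ 2 = b) by (rewrite pow2_sqrt; destruct H; lra).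
  assert (0 < sqrt b) by (apply sqrt_lt_R0; destruct H; lra).
  rewrite <- Hsb at 2; unfold curv, alpha2; field; destruct H; lra.
Qed.

Lemma continuous_complexity (a b m t : R) :
  continuous (fun t => complexity a b m (energy a b m t) t) t.
Proof.
unfold complexity.
repeat apply (continuous_minus (V := R_NormedModule)).
- apply continuous_const.
- apply (continuous_mult (fun _ => (b - a) / (2 * curv a b))
    (fun t => energy a b m t ^ 2)); [apply continuous_const|].
  apply (continuous_comp (energy a b m) (fun x => x ^ 2)).
  + apply continuous_energy.
  + apply (ex_derive_continuous (V := R_NormedModule) (fun x => x ^ 2)).
    now auto_derive.
- apply (ex_derive_continuous (V := R_NormedModule)
    (fun t => alpha2 a b / (2 * curv a b) * m ^ 2 * (t ^ 2 - 2))).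
  now auto_derive.
- apply (continuous_mult (fun _ => m) I1); [apply continuous_const|apply continuous_I1].
Qed.

Lemma log_ratio_gt0 (a b : R) : admissible a b -> 0 < ln (b / a).
Proof.
intros []; rewrite <- ln_1; apply ln_increasing; [lra|].
apply (Rmult_lt_reg_r a); auto; unfold Rdiv; rewrite Rmult_assoc, Rinv_l; lra.
Qed.

(** Forgetting the two squares, only the logarithm can pay for [m * I1 t]: this
    makes [complexity] negative far away, and forces the zeros to [sqrt 2] as the
    index grows. *)
Lemma complexity_I1_bound (a b m E t : R) : admissible a b -> 0 <= m -> sqrt 2 <= t ->
  complexity a b m E t <= / 2 * ln (b / a) - m * I1 t.
Proof.
intros H Hm Ht; assert (H0 := curv_gt0 a b H); assert (H2 := sqrt2_sq).
assert (H3 := sqrt2_bounds).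
assert (Hc1 : 0 <= (b - a) / (2 * curv a b) * E ^ 2).
{ apply Rmult_le_pos; [left; apply Rdiv_lt_0_compat; destruct H; lra|nra]. }
assert (Hc2 : 0 <= alpha2 a b / (2 * curv a b) * m ^ 2 * (t ^ 2 - 2)).
{ repeat apply Rmult_le_pos; try nra; [now destruct H|].
  left; apply Rinv_0_lt_compat; lra. }
unfold complexity; lra.
Qed.

Lemma complexity_zero (a b m : R) : admissible a b -> 0 < G a b -> 0 < m ->
  exists t, sqrt 2 < t /\ complexity a b m (energy a b m t) t = 0.
Proof.
intros H HG Hm.
assert (H3 := sqrt2_bounds).
(* Beyond 2 the slope of I1 is at least dI1 2 = sqrt 2 > 1, so that
   m * I1 T > ln (b / a) for this T. *)
set (T := 2 + ln (b / a) / m).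
assert (HL := log_ratio_gt0 a b H).
assert (HT : 0 < T - 2) by (unfold T; replace (2 + _ - 2) with (ln (b / a) / m) by ring;
  apply Rdiv_lt_0_compat; auto).
assert (HmT : m * (T - 2) = ln (b / a)) by (unfold T; field; lra).
assert (HTneg : complexity a b m (energy a b m T) T <= 0).
{ eapply Rle_trans; [apply complexity_I1_bound; auto; lra|].
  assert (HI := I1_increment 2 T ltac:(lra) ltac:(lra)).
  assert (HI2 := I1_gt0 2 ltac:(lra)).
  assert (Hr : 1 < dI1 2).
  { unfold dI1; replace (2 ^ 2 - 2) with 2 by ring; lra. }
  assert (T - 2 <= I1 T) by nra.
  nra. }
destruct (IVT_gen (fun t => complexity a b m (energy a b m t) t) (sqrt 2) T 0)
  as [t [Ht Ht0]].
- intros t; apply continuity_pt_filterlim, continuous_complexity.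
- rewrite complexity_start by auto; rewrite Rmin_right, Rmax_left by lra; lra.
- rewrite Rmin_left, Rmax_right in Ht by lra.
  exists t; split; auto.
  destruct (Rle_lt_or_eq_dec _ _ (proj1 Ht)) as [|Heq]; auto.
  rewrite <- Heq, complexity_start in Ht0 by auto; lra.
Qed.

Lemma complexity_zero_unique (a b m s t : R) : admissible a b -> 0 < m ->
  sqrt 2 < s -> sqrt 2 < t ->
  complexity a b m (energy a b m s) s = 0 ->
  complexity a b m (energy a b m t) t = 0 -> s = t.
Proof.
intros H Hm Hs Ht Hs0 Ht0; destruct (Rtotal_order s t) as [Hl|[|Hl]]; auto.
- assert (Hi := complexity_decr a b m s t H Hm ltac:(lra) Hl); lra.
- assert (Hi := complexity_decr a b m t s H Hm ltac:(lra) Hl); lra.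
Qed.

(** * Comparison of two indices *)

(** Fix an energy, and let [t] and [s] be its parameters for the larger index [n]
    and the smaller index [m]; then [t <= s].  Equality of the energies turns the
    difference of the squared terms into
    [/ 2 * (n * dI1 t + m * dI1 s) * (s - t)], and convexity of [I1] bounds
    [m * (I1 s - I1 t)] by [m * dI1 s * (s - t)].  What is left is at least
    [/ 2 * (n * dI1 t - m * dI1 s) * (s - t) + (n - m) * I1 t], where the first
    term is nonnegative and the second is positive. *)
Lemma complexity_decr_index (a b m n s t : R) : admissible a b ->
  0 < m -> m < n -> sqrt 2 < s -> sqrt 2 < t ->
  energy a b m s = energy a b n t ->
  complexity a b n (energy a b n t) t < complexity a b m (energy a b m s) s.
Proof.
intros H Hm Hmn Hs Ht Hl.
assert (H0 := curv_gt0 a b H).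
assert (HE := proj1 (energy_eq a b m s _ H) Hl).
rewrite (proj1 (energy_eq a b n t _ H) eq_refl) in HE.
rewrite Hl; generalize (energy a b n t); intros E.
assert (HA : 0 <= alpha2 a b) by apply H.
assert (Hws := dI1_gt0 s Hs); assert (Hwt := dI1_gt0 t Ht).
assert (Hts : t <= s).
{ apply Rnot_lt_le; intros Hst.
  assert (Hr := dI1_incr s t ltac:(lra) ltac:(lra)).
  assert (m * dI1 s <= n * dI1 t) by nra.
  nra. }
assert (HI := I1_increment t s ltac:(lra) Hts).
assert (HIt := I1_gt0 t Ht).
assert (Hd : alpha2 a b * (n * dI1 t - m * dI1 s) = curv a b * (s - t)) by lra.
unfold complexity; rewrite <- (dI1_sq s), <- (dI1_sq t) by lra.
assert (Hsq : alpha2 a b / (2 * curv a b) * n ^ 2 * dI1 t ^ 2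
  - alpha2 a b / (2 * curv a b) * m ^ 2 * dI1 s ^ 2
  = / 2 * (n * dI1 t + m * dI1 s) * (s - t)).
{ transitivity (/ (2 * curv a b) * (n * dI1 t + m * dI1 s)
    * (alpha2 a b * (n * dI1 t - m * dI1 s))).
  - field; lra.
  - rewrite Hd; field; lra. }
(* For alpha2 a b = 0 the energies determine the parameter, hence s = t. *)
assert (Hge : (s - t) * (m * dI1 s) <= (s - t) * (n * dI1 t)).
{ destruct (Req_dec s t) as [->|Hne]; [lra|].
  apply Rmult_le_compat_l; [lra|].
  assert (0 < curv a b * (s - t)) by (apply Rmult_lt_0_compat; lra).
  destruct (Rle_lt_or_eq_dec _ _ HA) as [HA'|HA']; [nra|].
  rewrite <- HA' in Hd; lra. }
assert (m * (I1 s - I1 t) <= m * (dI1 s * (s - t)))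
  by (apply Rmult_le_compat_l; lra).
assert (0 < (n - m) * I1 t) by (apply Rmult_lt_0_compat; lra).
lra.
Qed.

(** * The limiting quadratic polynomial *)

(** [- 2 * alpha2 a b] times [/ 2 * ln (b / a) + F a b (- sqrt 2) (- E)], the
    pointwise limit of the complexities; [E_infty_plus] is its largest root. *)
Definition limit_poly (a b E : R) : R :=
  (a + b) * E ^ 2 - 4 * a * sqrt b * E + 2 * curv a b - alpha2 a b * ln (b / a).

(** At a zero of [complexity], eliminating [m * dI1 t] through the energy
    equation leaves an identity in which [limit_poly] is a multiple of
    [t - sqrt 2] minus [2 * alpha2 a b * m * I1 t]; the latter is nonnegative, and
    at most [2 * alpha2 a b * m * dI1 t * (t - sqrt 2)].  The bounds do not involve
    [m], and hold for pure mixtures too. *)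
Lemma limit_poly_bounds (a b m t : R) : admissible a b -> 0 < m -> sqrt 2 < t ->
  let E := energy a b m t in
  complexity a b m E t = 0 ->
  0 <= limit_poly a b E <= 4 * a * sqrt b * E * (t - sqrt 2).
Proof.
intros H Hm Ht E Hz.
assert (H0 := curv_gt0 a b H).
assert (HA : 0 <= alpha2 a b) by apply H.
assert (Hw := dI1_gt0 t Ht).
assert (H2 := sqrt2_sq); assert (H3 := sqrt2_bounds).
assert (HI := I1_increment (sqrt 2) t ltac:(lra) ltac:(lra)).
assert (HI0 := I1_gt0 t Ht).
rewrite I1_sqrt2 in HI.
assert (HE := proj1 (energy_eq a b m t E H) eq_refl).
assert (Hsb : sqrt b ^ 2 = b) by (rewrite pow2_sqrt; destruct H; lra).
assert (HD : a * sqrt (2 * b) = sqrt 2 * a * sqrt b)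
  by (rewrite sqrt_mult by (destruct H; lra); ring).
assert (HD2 : (a * sqrt (2 * b)) ^ 2 = 2 * a ^ 2 * b)
  by (rewrite HD, !Rpow_mult_distr, H2, Hsb; ring).
assert (Hs : 4 * a * sqrt b = 2 * sqrt 2 * (a * sqrt (2 * b)))
  by (rewrite HD; transitivity (2 * sqrt 2 ^ 2 * a * sqrt b); [rewrite H2|]; ring).
assert (Hid : limit_poly a b E
  = (t - sqrt 2) * (2 * (a * sqrt (2 * b)) * E - curv a b * t - sqrt 2 * curv a b)
    - 2 * alpha2 a b * (m * I1 t)).
{ assert (Hq : alpha2 a b * m * dI1 t = a * sqrt (2 * b) * E - curv a b * t) by lra.
  assert (Hq2 : alpha2 a b * (alpha2 a b * m ^ 2 * (t ^ 2 - 2))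
     = (a * sqrt (2 * b) * E - curv a b * t) ^ 2)
   by (rewrite <- Hq, <- (dI1_sq t) by lra; ring).
  assert (Hz' : alpha2 a b * curv a b * ln (b / a) - (b - a) * alpha2 a b * E ^ 2
    - alpha2 a b * (alpha2 a b * m ^ 2 * (t ^ 2 - 2))
    - 2 * curv a b * alpha2 a b * m * I1 t = 0).
  { transitivity (2 * alpha2 a b * curv a b * complexity a b m E t).
    - unfold complexity; field; lra.
    - rewrite Hz; ring. }
  rewrite Hq2 in Hz'.
  assert (HP : curv a b * ((a + b) * E ^ 2)
    = (b - a) * alpha2 a b * E ^ 2 + 2 * a ^ 2 * b * E ^ 2)
   by (unfold curv, alpha2; ring).
  rewrite <- HD2 in HP.
  apply (Rmult_eq_reg_l (curv a b)); [|lra].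
  unfold limit_poly; rewrite Hs.
  generalize dependent (a * sqrt (2 * b)); intros D; intros.
  assert (H22 : curv a b ^ 2 * sqrt 2 ^ 2 = curv a b ^ 2 * 2) by now rewrite H2.
  nra. }
rewrite Hid, Hs.
assert (HmI : alpha2 a b * (m * I1 t)
   <= (t - sqrt 2) * (a * sqrt (2 * b) * E - curv a b * t)).
{ replace ((t - sqrt 2) * (a * sqrt (2 * b) * E - curv a b * t))
   with (alpha2 a b * (m * (dI1 t * (t - sqrt 2)))) by (rewrite HE; ring).
  apply Rmult_le_compat_l; auto; apply Rmult_le_compat_l; lra. }
assert (HmI0 : 0 <= alpha2 a b * (m * I1 t)).
{ apply Rmult_le_pos; [exact HA|apply Rmult_le_pos; lra]. }
assert (Hsq : 0 <= (t - sqrt 2) * (curv a b * (t - sqrt 2)))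
  by (repeat apply Rmult_le_pos; lra).
assert (Hup : 0 <= (t - sqrt 2) * (curv a b * (t + sqrt 2)))
  by (repeat apply Rmult_le_pos; lra).
assert (HDE : 0 <= (t - sqrt 2) * (a * sqrt (2 * b) * E * (sqrt 2 - 1))).
{ rewrite HE; repeat apply Rmult_le_pos; try lra.
  apply Rplus_le_le_0_compat; repeat apply Rmult_le_pos; lra. }
split; lra.
Qed.

(** Complete the square: with [v] the vertex and [v + r] the largest root,
    [limit_poly] is [(a + b) * ((E - v)^2 - r^2)].  Since [v <= E_infty < E],
    nonnegativity puts [E] above the largest root, and there
    [(E - v - r)^2 <= (E - v)^2 - r^2]. *)
Lemma E_infty_plus_gap (a b E : R) : admissible a b -> 0 < G a b ->
  E_infty a b < E -> 0 <= limit_poly a b E ->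
  0 <= E - E_infty_plus a b <= sqrt (limit_poly a b E / (a + b)).
Proof.
intros H HG HE HP.
assert (H0 := curv_gt0 a b H).
assert (HA : 0 <= alpha2 a b) by apply H.
assert (Ha : 0 < a) by apply H; assert (Hab : a < b) by apply H.
assert (Hsb : sqrt b ^ 2 = b) by (rewrite pow2_sqrt; lra).
assert (Hs : 0 < sqrt b) by (apply sqrt_lt_R0; lra).
unfold E_infty_plus.
set (D := 4 * b * a ^ 2 - _).
assert (Hkey : curv a b * (a + b) = 2 * a ^ 2 * b + (b - a) * alpha2 a b)
  by (unfold curv, alpha2; ring).
(* The discriminant is nonnegative because G a b > 0 implies
   ln (b / a) >= 2 * (b - a) / (b + a). *)
assert (HD : 0 <= D).
{ assert (HL : 2 * (b - a) <= (a + b) * ln (b / a)).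
  { unfold G in HG; fold (curv a b) in HG.
    assert (HG' : (b - a) * curv a b / (b * a ^ 2) < ln (b / a)) by lra.
    assert (H1 : 2 * (b - a) <= (a + b) * ((b - a) * curv a b / (b * a ^ 2))).
    { replace ((a + b) * ((b - a) * curv a b / (b * a ^ 2)))
        with (2 * (b - a) + (b - a) ^ 2 * alpha2 a b / (b * a ^ 2)).
      - assert (0 <= (b - a) ^ 2 * alpha2 a b / (b * a ^ 2)); [|lra].
        apply Rmult_le_pos; [apply Rmult_le_pos; [nra|lra]|].
        left; apply Rinv_0_lt_compat, Rmult_lt_0_compat; [lra|nra].
      - transitivity ((b - a) * (curv a b * (a + b)) / (b * a ^ 2)); [|field; lra].
        rewrite Hkey; field; lra. }
    apply Rle_trans with (1 := H1), Rmult_le_compat_l; lra. }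
  unfold D; fold (curv a b).
  replace (4 * b * a ^ 2 - (b + a) * (2 * curv a b - alpha2 a b * ln (b / a)))
    with (alpha2 a b * ((a + b) * ln (b / a) - 2 * (b - a))).
  - apply Rmult_le_pos; lra.
  - transitivity (4 * b * a ^ 2 - 2 * (curv a b * (a + b))
      + (a + b) * alpha2 a b * ln (b / a)); [rewrite Hkey|]; ring. }
assert (HPE : (a + b) * limit_poly a b E
   = ((a + b) * E - 2 * a * sqrt b) ^ 2 - sqrt D ^ 2).
{ rewrite pow2_sqrt by auto; unfold D, limit_poly; fold (curv a b).
  transitivity ((a + b) ^ 2 * E ^ 2 - 4 * (a + b) * a * sqrt b * E
    + 4 * a ^ 2 * sqrt b ^ 2 - (4 * a ^ 2 * b
    - (a + b) * (2 * curv a b - alpha2 a b * ln (b / a))));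
   [rewrite Hsb|]; ring. }
assert (Hv : 0 < (a + b) * E - 2 * a * sqrt b).
{ assert (Hei : E_infty a b * (a * sqrt b) = curv a b)
    by (unfold E_infty, curv, alpha2; field; lra).
  assert (Hc : curv a b < E * (a * sqrt b)) by (rewrite <- Hei; apply Rmult_lt_compat_r; nra).
  apply (Rmult_lt_reg_l (a * sqrt b)); [nra|].
  rewrite Rmult_0_r.
  replace (a * sqrt b * ((a + b) * E - 2 * a * sqrt b))
    with ((a + b) * (E * (a * sqrt b)) - 2 * a ^ 2 * sqrt b ^ 2) by ring.
  rewrite Hsb; nra. }
assert (Hr := sqrt_pos D).
set (r := sqrt D) in *; set (X := (a + b) * E - 2 * a * sqrt b) in *.
assert (HXr : r <= X) by nra.
replace (E - (2 * a * sqrt b + r) / (a + b)) with ((X - r) / (a + b))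
  by (unfold X; field; lra).
split.
- apply Rmult_le_pos; [lra|left; apply Rinv_0_lt_compat; lra].
- assert (0 < / (a + b)) by (apply Rinv_0_lt_compat; lra).
  rewrite <- (sqrt_pow2 ((X - r) / (a + b))) by (apply Rmult_le_pos; lra).
  apply sqrt_le_1_alt.
  replace (limit_poly a b E / (a + b))
    with ((a + b) * limit_poly a b E * (/ (a + b)) ^ 2) by (field; lra).
  rewrite HPE; unfold Rdiv; rewrite Rpow_mult_distr.
  apply Rmult_le_compat_r; nra.
Qed.

(** * Moments of a mixture *)

Lemma is_series_ge0 (f : nat -> R) (l : R) :
  is_series f l -> (forall n, 0 <= f n) -> 0 <= l.
Proof.
intros Hl Hf.
rewrite <- (is_series_unique _ _ Hl), <- (Rmult_0_l (Series f)), <- Series_scal_l.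
apply Series_le; [intros n; specialize (Hf n); lra|now exists l].
Qed.

(** The terms [2 ^ p * beta p] are bounded, and their squares are
    [4 ^ p * beta p ^ 2]. *)
Lemma mixture_radius (beta : nat -> R) : is_mixture beta ->
  Rbar_lt (Rabs 1) (CV_radius (fun p => beta p ^ 2)).
Proof.
intros (_ & _ & Hpos & Hex & _).
apply Rbar_lt_le_trans with 4; [rewrite Rabs_R1; simpl; lra|].
assert (Hl := ex_series_lim_0 _ Hex).
apply is_lim_seq_spec in Hl; destruct (Hl (mkposreal 1 Rlt_0_1)) as [N HN].
simpl in HN.
destruct (CV_radius_bounded (fun p => beta p ^ 2)) as [Hub _].
apply Hub.
assert (Hb : forall n, exists M, forall p, (p < n)%nat -> Rabs (beta p ^ 2 * 4 ^ p) <= M).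
{ induction n as [|n [M HM]]; [exists 0; intros p Hp; lia|].
  exists (Rmax M (Rabs (beta n ^ 2 * 4 ^ n))); intros p Hp.
  destruct (Nat.eq_dec p n) as [->|Hn]; [apply Rmax_r|].
  eapply Rle_trans; [apply HM; lia|apply Rmax_l]. }
destruct (Hb N) as [M HM].
exists (Rmax M 1); intros p; destruct (Nat.lt_ge_cases p N) as [Hp|Hp].
- eapply Rle_trans; [now apply HM|apply Rmax_l].
- eapply Rle_trans; [|apply Rmax_r].
  assert (H := HN p Hp); rewrite Rminus_0_r in H.
  replace (beta p ^ 2 * 4 ^ p) with ((2 ^ p * beta p) ^ 2).
  + rewrite <- RPow_abs; assert (H0 := Rabs_pos (2 ^ p * beta p)); nra.
  + rewrite Rpow_mult_distr, <- pow_mult, Nat.mul_comm, pow_mult.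
    replace (2 ^ 2) with 4 by ring; ring.
Qed.

Lemma is_series_nu1 (beta : nat -> R) : is_mixture beta ->
  is_series (fun p => INR p * beta p ^ 2) (nu1 beta).
Proof.
intros H; assert (Hr := mixture_radius beta H).
apply is_pseries_derive, is_pseries_R in Hr.
apply is_series_decr_1.
match goal with |- is_series _ ?l => replace l with (nu1 beta) end.
- revert Hr; apply is_series_ext; intros n; rewrite pow1, Rmult_1_r; reflexivity.
- simpl; unfold plus, opp; simpl; ring.
Qed.

Lemma is_series_nu2 (beta : nat -> R) : is_mixture beta ->
  is_series (fun p => INR p * (INR p - 1) * beta p ^ 2) (nu2 beta).
Proof.
intros H; assert (Hr := mixture_radius beta H).
assert (Hv := Derive_n_PSeries 2 _ _ Hr).
rewrite <- (CV_radius_derive_n 2) in Hr.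
apply CV_radius_inside, PSeries_correct in Hr; rewrite <- Hv in Hr.
apply is_pseries_R in Hr.
apply is_series_decr_n with 2%nat; [lia|].
match goal with |- is_series _ ?l => replace l with (nu2 beta) end.
- revert Hr; apply is_series_ext; intros n; rewrite pow1, Rmult_1_r.
  unfold PS_derive_n; rewrite (Nat.add_comm n 2).
  change (Factorial.fact (2 + n)) with (S (S n) * (S n * Factorial.fact n))%nat.
  rewrite !mult_INR, !plus_INR, !S_INR; simpl INR.
  match goal with |- ?x = ?y => change (@eq R x y) end.
  field; apply INR_fact_neq_0.
- simpl; rewrite sum_Sn, sum_O; unfold plus, opp; simpl; ring.
Qed.

(** Regard [beta p ^ 2] as the law of a random integer [p >= 2].  Then
    [nu'(1)] is the mean of [p], [nu''(1)] is the mean of [p * (p - 1)], and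
    [alpha2] is the variance of [p].  Equality of the two derivatives would make
    [G] vanish. *)
Lemma mixture_admissible (beta : nat -> R) :
  is_mixture beta -> pure_like beta -> admissible (nu1 beta) (nu2 beta).
Proof.
intros H HG.
assert (S1 := is_series_nu1 beta H); assert (S2 := is_series_nu2 beta H).
destruct H as (H0 & H1 & _ & _ & S0).
unfold pure_like in HG.
revert S1 S2 HG; generalize (nu1 beta) (nu2 beta); intros a b S1 S2 HG.
assert (Ha : 0 <= a - 1).
{ refine (is_series_ge0 _ _ (is_series_minus _ _ _ _ S1 S0) _).
  intros p; unfold plus, opp; simpl.
  destruct p as [|p]; [rewrite H0; lra|].
  rewrite S_INR; assert (Hp := pos_INR p); nra. }
assert (Hb : 0 <= b - a).
{ refine (is_series_ge0 _ _ (is_series_minus _ _ _ _ S2 S1) _).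
  intros p; unfold plus, opp; simpl.
  destruct p as [|[|p]]; [rewrite H0; simpl; lra|rewrite H1; simpl; lra|].
  rewrite !S_INR; assert (Hp := pos_INR p).
  assert (0 <= beta (S (S p)) ^ 2) by nra.
  assert (0 <= (INR p + 2) * INR p) by nra.
  nra. }
assert (HA : 0 <= b + (1 - 2 * a) * a + a ^ 2 * 1).
{ refine (is_series_ge0 _ _ (is_series_plus _ _ _ _ (is_series_plus _ _ _ _ S2
    (is_series_scal (1 - 2 * a) _ _ S1)) (is_series_scal (a ^ 2) _ _ S0)) _).
  intros p; unfold plus, scal; simpl; unfold mult; simpl.
  assert (0 <= (beta p * (INR p - a)) ^ 2) by apply pow2_ge_0; lra. }
split; [lra| |unfold alpha2; lra].
destruct (Rle_lt_or_eq_dec a b ltac:(lra)) as [|<-]; auto.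
unfold G, Rdiv in HG; rewrite Rinv_r, ln_1 in HG by lra.
replace (a - a) with 0 in HG by ring; lra.
Qed.

(** * The complexity functions of mixtures *)

(** For fixed [E], the critical parameter [tx x] at [alpha = x] solves
    [a * sqrt (2 * b) * E = curv a b * tx x + x ^ 2 * m * dI1 (tx x)], with [b]
    the function of [x] prescribed by the definition of the limit.  As
    [0 <= dI1 (tx x) <= tx x], it lies between two explicit functions that both
    tend to [t].  Then [complexity] passes to the limit, having no pole. *)
Lemma theta_mixed_pure_limit (a b : R) (k : nat) (t : R) :
  admissible a b -> alpha2 a b = 0 -> sqrt 2 < t ->
  let E := energy a b (INR k + 1) t in
  is_lim (fun alpha => theta_mixed a (a ^ 2 - a + alpha ^ 2) k (- E)) 0
    (complexity a b (INR k + 1) E t).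
Proof.
intros H HA Ht E.
set (m := INR k + 1).
assert (Hm : 0 < m) by (unfold m; assert (Hk := pos_INR k); lra).
set (bb := fun alpha => a ^ 2 - a + alpha ^ 2).
assert (Hb : b = a ^ 2 - a) by (unfold alpha2 in HA; lra).
assert (Hbb0 : bb 0 = b) by (unfold bb; rewrite Hb; ring).
assert (Hb1 : a * (a * 1) - a + 0 * (0 * 1) = b) by (rewrite Hb; ring).
assert (HAbb : forall x, alpha2 a (bb x) = x ^ 2) by (intros x; unfold alpha2, bb; ring).
assert (Hadm : forall x, admissible a (bb x)).
{ intros x; assert (Hx := pow2_ge_0 x); destruct H; split; auto.
  - unfold bb; rewrite <- Hb; lra.
  - now rewrite HAbb. }
assert (HDE := proj1 (energy_eq a b m t E H) eq_refl).
rewrite HA in HDE.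
assert (H0 := curv_gt0 a b H); assert (HD := scale_gt0 a b H).
assert (Ha : 0 < a) by apply H; assert (Hab : a < b) by apply H.
assert (HE0 : E_infty a b < E) by (apply (energy_gt a b m t); [exact H|lra|exact Ht]).
assert (Hcont : forall f : R -> R, ex_derive f 0 -> is_lim f 0 (f 0)).
{ intros f Hf; apply is_lim_continuity, continuity_pt_filterlim.
  now apply (ex_derive_continuous (V := R_NormedModule)). }
assert (Hnear : Rbar_locally' 0 (fun x => x <> 0 /\ E_infty a (bb x) < E)).
{ assert (Hl : is_lim (fun x => E_infty a (bb x)) 0 (E_infty a (bb 0))).
  { apply Hcont; unfold E_infty, alpha2, bb.
    assert (Hsb : 0 < sqrt b) by (apply sqrt_lt_R0; lra).
    auto_derive.
    rewrite ?Hb1.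
    repeat split; [lra|].
    apply Rgt_not_eq, Rmult_lt_0_compat; lra. }
  rewrite Hbb0 in Hl.
  apply filter_and.
  - exists (mkposreal 1 Rlt_0_1); intros x _ Hx; exact Hx.
  - apply (Hl (fun y => y < E)); exact (open_lt E (E_infty a b) HE0). }
set (tx := fun x => - lambda_star a (bb x) k (- E)).
assert (Htt : forall x, x <> 0 -> E_infty a (bb x) < E ->
  sqrt 2 < tx x /\ energy a (bb x) m (tx x) = E).
{ intros x Hx HEx.
  destruct (energy_surj a (bb x) m E (Hadm x) ltac:(lra) HEx) as [s [Hs HsE]].
  assert (Hls := lambda_star_energy a (bb x) k s (Hadm x)
    ltac:(rewrite HAbb; apply pow2_gt_0; exact Hx) Hs).
  fold m in Hls; rewrite HsE in Hls; unfold tx; rewrite Hls, Ropp_involutive; auto. }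
assert (Htlim : is_lim tx 0 t).
{ assert (Hsb : 0 < 2 * b) by lra.
  assert (Hex : forall n, 0 <= n ->
    is_lim (fun x => a * sqrt (2 * bb x) * E / (curv a (bb x) + x ^ 2 * n)) 0 t).
  { intros n Hn.
    replace t with (a * sqrt (2 * bb 0) * E / (curv a (bb 0) + 0 ^ 2 * n))
      by (rewrite Hbb0, HDE; field; lra).
    apply (Hcont (fun x => a * sqrt (2 * bb x) * E / (curv a (bb x) + x ^ 2 * n))).
    unfold curv, bb; auto_derive.
    rewrite ?Hb1.
    unfold curv in H0.
    split; [|split; [|exact I]]; [lra|].
    replace (_ + _) with (b - a + a ^ 2) by ring; lra. }
  refine (is_lim_le_le_loc _ _ _ _ _ _ (Hex m ltac:(lra)) (Hex 0 (Rle_refl 0))).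
  revert Hnear; apply filter_imp; intros x [Hx HEx].
  destruct (Htt x Hx HEx) as [Hs HsE].
  apply (energy_eq a (bb x) m _ E (Hadm x)) in HsE; rewrite HAbb in HsE.
  assert (Hc := curv_gt0 _ _ (Hadm x)).
  assert (Hr := dI1_le (tx x) ltac:(lra)); assert (Hr0 := dI1_ge0 (tx x)).
  assert (Hxm : 0 <= x ^ 2 * m) by (apply Rmult_le_pos; [apply pow2_ge_0|lra]).
  rewrite HsE; split.
  - apply (Rmult_le_reg_r (curv a (bb x) + x ^ 2 * m)); [lra|].
    unfold Rdiv; rewrite Rmult_assoc, Rinv_l by lra; nra.
  - apply (Rmult_le_reg_r (curv a (bb x) + x ^ 2 * 0)); [lra|].
    unfold Rdiv; rewrite Rmult_assoc, Rinv_l by lra; nra. }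
apply is_lim_ext_loc with (fun x => complexity a (bb x) m E (tx x)).
{ revert Hnear; apply filter_imp; intros x [Hx HEx].
  destruct (Htt x Hx HEx) as [Hs HsE].
  assert (Hth := theta_mixed_energy a (bb x) k (tx x) (Hadm x)
    ltac:(rewrite HAbb; apply pow2_gt_0; exact Hx) Hs).
  fold m in Hth; cbv zeta in Hth; rewrite HsE in Hth; symmetry; exact Hth. }
unfold complexity; rewrite <- Hbb0.
assert (Hsq : continuous (fun s => s ^ 2 - 2) t).
{ apply (ex_derive_continuous (V := R_NormedModule) (fun s => s ^ 2 - 2)).
  now auto_derive. }
apply is_lim_minus'; [apply is_lim_minus'|].
- apply (Hcont (fun x => / 2 * ln (bb x / a) - (bb x - a) / (2 * curv a (bb x)) * E ^ 2)).
  unfold curv, bb; auto_derive.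
  rewrite ?Hb1.
  unfold curv in H0.
  assert (0 < b * / a) by (apply Rmult_lt_0_compat; [lra|now apply Rinv_0_lt_compat]).
  repeat split; try lra.
- apply (is_lim_mult (fun x => alpha2 a (bb x) / (2 * curv a (bb x)) * m ^ 2)
    (fun x => tx x ^ 2 - 2) 0 (alpha2 a (bb 0) / (2 * curv a (bb 0)) * m ^ 2) (t ^ 2 - 2)).
  + apply (Hcont (fun x => alpha2 a (bb x) / (2 * curv a (bb x)) * m ^ 2)).
    unfold curv, alpha2, bb; auto_derive.
    rewrite ?Hb1.
    unfold curv in H0; repeat split; lra.
  + exact (is_lim_comp_continuous tx (fun s => s ^ 2 - 2) 0 t Htlim Hsq).
  + exact I.
- apply (is_lim_mult (fun _ => m) (fun x => I1 (tx x)) 0 m (I1 t)).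
  + apply is_lim_const.
  + exact (is_lim_comp_continuous tx I1 0 t Htlim (continuous_I1 t)).
  + exact I.
Qed.

Lemma theta_energy (beta : nat -> R) (k : nat) (t : R) :
  let a := nu1 beta in let b := nu2 beta in
  admissible a b -> sqrt 2 < t ->
  let E := energy a b (INR k + 1) t in
  theta beta k (- E) = Finite (complexity a b (INR k + 1) E t).
Proof.
intros a b H Ht E; unfold theta; fold a b.
destruct (Req_EM_T (alpha2 a b) 0) as [HA|HA].
- apply is_lim_unique, theta_mixed_pure_limit; auto.
- f_equal; apply theta_mixed_energy; auto.
  destruct H as [_ _ HA']; lra.
Qed.

(** * The sequence of energy levels *)

Lemma E_level_spec (beta : nat -> R) (k : nat) :
  let a := nu1 beta in let b := nu2 beta in
  admissible a b -> 0 < G a b ->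
  exists t, sqrt 2 < t /\ E_level beta k = energy a b (INR k + 1) t /\
    complexity a b (INR k + 1) (energy a b (INR k + 1) t) t = 0.
Proof.
intros a b H HG.
assert (Hm : 0 < INR k + 1) by (assert (Hk := pos_INR k); lra).
destruct (complexity_zero a b (INR k + 1) H HG Hm) as [t [Ht Hz]].
exists t; repeat split; auto.
unfold E_level; fold a b; apply (iota_unique (V := R_CompleteNormedModule)).
- intros E [HE Hth].
  destruct (energy_surj a b (INR k + 1) E H ltac:(lra) HE) as [s [Hs <-]].
  unfold a, b in Hth; rewrite theta_energy in Hth by auto; fold a b in Hth.
  injection Hth as Hth.
  now rewrite (complexity_zero_unique a b (INR k + 1) s t).
- split; [now apply energy_gt; [| lra|]|].
  unfold a, b; rewrite theta_energy by auto; fold a b; now rewrite Hz.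
Qed.

Lemma E_level_decr (beta : nat -> R) (j k : nat) :
  admissible (nu1 beta) (nu2 beta) -> 0 < G (nu1 beta) (nu2 beta) ->
  (j < k)%nat -> E_level beta k < E_level beta j.
Proof.
intros H HG Hjk.
destruct (E_level_spec beta j H HG) as [s [Hs [-> Hs0]]].
destruct (E_level_spec beta k H HG) as [t [Ht [-> Ht0]]].
assert (Hj := pos_INR j); assert (Hk := lt_INR j k Hjk).
revert H HG Hs0 Ht0; generalize (nu1 beta) (nu2 beta); intros a b H HG Hs0 Ht0.
destruct (energy_surj a b (INR j + 1) (energy a b (INR k + 1) t) H ltac:(lra))
  as [r [Hr Hrt]]; [apply energy_gt; auto; lra|].
assert (Hi := complexity_decr_index a b (INR j + 1) (INR k + 1) r t H
  ltac:(lra) ltac:(lra) Hr Ht Hrt).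
rewrite <- Hrt; apply energy_incr; auto; try lra.
destruct (Rtotal_order r s) as [|[->|Hsr]]; auto; [lra|].
(* r lies beyond s, so its complexity would be negative. *)
assert (Hd := complexity_decr a b (INR j + 1) s r H ltac:(lra) ltac:(lra) Hsr).
lra.
Qed.

Lemma complexity_zero_near_sqrt2 (a b e : R) : admissible a b -> 0 < e ->
  exists N, forall k t, (N <= k)%nat -> sqrt 2 < t ->
    complexity a b (INR k + 1) (energy a b (INR k + 1) t) t = 0 -> t < sqrt 2 + e.
Proof.
intros H He.
assert (Hd := I1_gt0 (sqrt 2 + e) ltac:(lra)).
destruct (INR_unbounded (ln (b / a) / I1 (sqrt 2 + e))) as [N HN].
exists N; intros k t Hk Ht Hz; apply Rnot_le_lt; intros Hle.
assert (HI : I1 (sqrt 2 + e) <= I1 t).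
{ destruct Hle as [Hlt| <-]; [left; apply I1_incr; lra|lra]. }
assert (HL := log_ratio_gt0 a b H).
assert (Hb := complexity_I1_bound a b (INR k + 1) (energy a b (INR k + 1) t) t H
  ltac:(assert (Hp := pos_INR k); lra) ltac:(lra)).
apply le_INR in Hk.
assert (HN' : ln (b / a) < INR N * I1 (sqrt 2 + e)).
{ apply (Rmult_lt_compat_r _ _ _ Hd) in HN.
  unfold Rdiv in HN; rewrite Rmult_assoc, Rinv_l in HN by lra; lra. }
assert (INR N * I1 (sqrt 2 + e) <= (INR k + 1) * I1 t).
{ apply Rmult_le_compat; try lra; apply pos_INR. }
lra.
Qed.

Lemma E_level_lim (beta : nat -> R) :
  admissible (nu1 beta) (nu2 beta) -> 0 < G (nu1 beta) (nu2 beta) ->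
  is_lim_seq (E_level beta) (E_infty_plus (nu1 beta) (nu2 beta)).
Proof.
intros H HG.
set (a := nu1 beta) in *; set (b := nu2 beta) in *.
assert (Ha : 0 < a) by apply H; assert (Hab : a < b) by apply H.
assert (Hs : 0 < sqrt b) by (apply sqrt_lt_R0; lra).
assert (HEi := E_infty_gt0 a b H).
assert (HE0 : forall k, E_infty a b < E_level beta k <= E_level beta 0).
{ intros k; split.
  - destruct (E_level_spec beta k H HG) as [t [Ht [-> _]]].
    apply energy_gt; auto; assert (Hp := pos_INR k); lra.
  - destruct k as [|k]; [lra|]; left; apply E_level_decr; auto; lia. }
set (C := 4 * a * sqrt b * E_level beta 0).
assert (HC : 0 < C) by (specialize (HE0 0%nat); unfold C; repeat apply Rmult_lt_0_compat; lra).
apply is_lim_seq_spec; intros eps.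
assert (Heps := cond_pos eps).
destruct (complexity_zero_near_sqrt2 a b ((a + b) * eps ^ 2 / C) H) as [N HN].
{ apply Rdiv_lt_0_compat; auto; apply Rmult_lt_0_compat; [lra|nra]. }
exists N; intros k Hk.
destruct (E_level_spec beta k H HG) as [t [Ht [HEk Hz]]]; fold a b in HEk, Hz.
assert (Hp := pos_INR k).
assert (Htn := HN k t Hk Ht Hz).
assert (HP := limit_poly_bounds a b (INR k + 1) t H ltac:(lra) Ht Hz).
cbv zeta in HP; rewrite <- HEk in HP.
destruct (HE0 k) as [HEk1 HEk2].
assert (Hgap := E_infty_plus_gap a b _ H HG HEk1 (proj1 HP)).
assert (HPs : limit_poly a b (E_level beta k) < (a + b) * eps ^ 2).
{ apply Rle_lt_trans with (1 := proj2 HP).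
  apply Rle_lt_trans with (C * (t - sqrt 2)).
  - apply Rmult_le_compat_r; [lra|]; apply Rmult_le_compat_l; [|exact HEk2].
    repeat apply Rmult_le_pos; lra.
  - apply (Rmult_lt_reg_r (/ C)); [now apply Rinv_0_lt_compat|].
    replace (C * (t - sqrt 2) * / C) with (t - sqrt 2) by (field; lra).
    unfold Rdiv in Htn; lra. }
rewrite Rabs_right by lra.
apply Rle_lt_trans with (1 := proj2 Hgap).
rewrite <- (sqrt_pow2 eps) by lra.
apply sqrt_lt_1_alt; split.
- apply Rmult_le_pos; [lra|left; apply Rinv_0_lt_compat; lra].
- apply (Rmult_lt_reg_r (a + b)); [lra|].
  unfold Rdiv; rewrite Rmult_assoc, Rinv_l by lra; lra.
Qed.

Theorem proposition5 (beta : nat -> R)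
  (hmix : is_mixture beta) (hpl : pure_like beta) :
  (forall j k : nat, (j < k)%nat -> E_level beta k < E_level beta j) /\
  is_lim_seq (E_level beta) (Finite (E_infty_plus (nu1 beta) (nu2 beta))).
Proof.
assert (H := mixture_admissible beta hmix hpl).
split; [intros j k; now apply E_level_decr|now apply E_level_lim].
Qed.
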